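(* Let $m\ge1$, let $\mathbf{v}\in L^2(\mathbb{R}^m,\mathbb{R}^{3}\subset C\ell_{3,0})$ be a square integrable vector field with $\|\mathbf{v}\|_{L^2}\ne0$, and let $\mathbf{P}\in C\ell_{3,0}$ be a unit bivector. Let $\beta:[0,\pi)\to[0,\pi)$ be the function defined by $$\beta(\alpha)=2\arg\left(e^{\frac{\alpha}{2}\mathbf{P}}\,e^{\frac{\varphi}{2}\mathbf{Q}}\right),$$ where $\varphi\in[0,\pi]$ and the unit bivector $\mathbf{Q}$ (both depending on $\alpha$) are the angle and the bivector of the polar form $r\,e^{\varphi\mathbf{Q}}$, $r\ge 0$, of the normalized geometric cross correlation $$\frac{(\mathrm{R}_{\mathbf{P},\alpha}(\mathbf{v})\star\mathbf{v})(0)}{\|\mathrm{R}_{\mathbf{P},\alpha}(\mathbf{v})\|_{L^2}\,\|\mathbf{v}\|_{L^2}}.$$ Then for every $\alpha\in[0,\pi)$ the sequence defined by $\alpha_0=\alpha$, $\alpha_{n+1}=\beta(\alpha_n)$ converges to zero.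
   Context: $C\ell_{3,0}$ is the real Clifford (geometric) algebra of Euclidean $\mathbb{R}^3$, with orthonormal basis vectors satisfying $\mathbf{e}_i^2=1$, $\mathbf{e}_i\mathbf{e}_j=-\mathbf{e}_j\mathbf{e}_i$ for $i\ne j$; $\mathbb{R}^3$ is identified with the grade-1 part. $\langle A\rangle_k$ denotes the grade-$k$ part of a multivector $A$. A unit bivector $\mathbf{P}$ is a bivector (grade 2 element) with $\mathbf{P}^2=-1$; for a bivector $B$, $\|B\|\ge 0$ is defined by $B^2=-\|B\|^2$. For a unit bivector $\mathbf{P}$ and real $t$, $e^{t\mathbf{P}}=\cos t+\sin t\,\mathbf{P}$. Outer rotation of a vector field by the angle $\alpha$ in the plane spanned by $\mathbf{P}$: $\mathrm{R}_{\mathbf{P},\alpha}(\mathbf{v})(\mathbf{x})=e^{-\frac{\alpha}{2}\mathbf{P}}\,\mathbf{v}(\mathbf{x})\,e^{\frac{\alpha}{2}\mathbf{P}}$. $\|\mathbf{v}\|_{L^2}^2=\int_{\mathbb{R}^m}\mathbf{v}(\mathbf{x})^2\,d^m\mathbf{x}$. The geometric cross correlation of $\mathbf{A},\mathbf{B}:\mathbb{R}^m\to C\ell_{3,0}$ is $(\mathbf{A}\star\mathbf{B})(\mathbf{x})=\int_{\mathbb{R}^m}\overline{\mathbf{A}(\mathbf{y})}\,\mathbf{B}(\mathbf{y}+\mathbf{x})\,d^m\mathbf{y}$, where the overbar is reversion, $\overline{A}=\sum_{k=0}^{3}(-1)^{\frac12 k(k-1)}\langle A\rangle_k$ (so $\overline{\mathbf{v}}=\mathbf{v}$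 for vectors). The correlation of two vector fields at $0$ is a sum of a scalar and a bivector. For an element $C=\langle C\rangle_0+\langle C\rangle_2$ (scalar plus bivector), $\arg(C)=\operatorname{atan2}(\|\langle C\rangle_2\|,\langle C\rangle_0)\in[0,\pi]$. Its polar form is $C=r\,e^{\varphi\mathbf{Q}}$ with $r\ge0$, $\varphi=\arg(C)$, and $\mathbf{Q}=\langle C\rangle_2/\|\langle C\rangle_2\|$ if $\langle C\rangle_2\neq0$, and $\mathbf{Q}$ an arbitrary unit bivector otherwise.
   Formalization: The formal theorem additionally assumes that v is not almost everywhere fixed by all rotations in the plane of P; otherwise (e.g. P = e1e2, v = f e3) the correlation is 1, φ = 0 and β(α) = α, so the sequence is constant and the claim fails. *)

(* Defs.v *)
From HB Require Import structures.
From mathcomp Require Import all_boot all_order all_algebra.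
From mathcomp Require Import all_classical all_reals all_analysis.
From mathcomp Require Import ring lra.
Import Order.TTheory GRing.Theory Num.Theory.
Import numFieldNormedType.Exports.

Set Implicit Arguments.
Unset Strict Implicit.
Unset Printing Implicit Defensive.

Local Open Scope classical_set_scope.
Local Open Scope ring_scope.

(* The index of the product of the basis blades e_I and e_J. *)
Definition symdiff (I J : {set 'I_3}) : {set 'I_3} :=
  ((I :\: J) :|: (J :\: I))%SET.

Lemma in_symdiff I J i : (i \in symdiff I J) = (i \in I) (+) (i \in J).
Proof. by rewrite !inE; case: (i \in I); case: (i \in J). Qed.

Lemma symdiffA : associative symdiff.
Proof. by move=> I J K; apply/setP => i; rewrite !in_symdiff addbA. Qed.

Lemma symdiffC : commutative symdiff.
Proof. by move=> I J; apply/setP => i; rewrite !in_symdiff addbC. Qed.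

Lemma symdiff0l : left_id finset.set0 symdiff.
Proof. by move=> I; apply/setP => i; rewrite !in_symdiff inE. Qed.

Lemma symdiffv I : symdiff I I = finset.set0.
Proof. by apply/setP => i; rewrite !in_symdiff inE addbb. Qed.

Lemma symdiffK I : involutive (symdiff I).
Proof. by move=> J; rewrite symdiffA symdiffv symdiff0l. Qed.

Section clifford_algebra.
Variable R : realType.

(* [A I] is the coefficient of A on the blade e_I = e_i1 e_i2 .. e_ik, where
   I = {i1 < i2 < .. < ik} *)
Definition cl3 := {ffun {set 'I_3} -> R^o}.

HB.instance Definition _ := GRing.Lmodule.copy cl3 {ffun {set 'I_3} -> R^o}.

(* e_I e_J = blade_sign I J e_(symdiff I J): bringing the factors of e_I e_J in
   increasing order takes one transposition for each pair i > j, i in I, j in J,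
   and then e_i e_i = 1 for i in both I and J. *)
Definition blade_sign (I J : {set 'I_3}) : R :=
  \prod_(i in I) \prod_(j in J | (j < i)%N) -1.

Definition blade (I : {set 'I_3}) : cl3 := [ffun J => (J == I)%:R].

Definition cl_mul (A B : cl3) : cl3 :=
  [ffun K => \sum_I blade_sign I (symdiff I K) * (A I * B (symdiff I K))].

Let sign_symdiff (I J : {set 'I_3}) (F : 'I_3 -> R) : (forall i, F i * F i = 1) ->
  \prod_(i in symdiff I J) F i = (\prod_(i in I) F i) * \prod_(i in J) F i.
Proof.
move=> FF; rewrite !(big_mkcond (fun i => i \in _)) -big_split; apply: eq_bigr => i _.
by rewrite in_symdiff; case: (i \in I); case: (i \in J); rewrite /= ?mulr1 ?mul1r ?FF.
Qed.

Let sqr_prod (P : pred 'I_3) (F : 'I_3 -> R) : (forall i, F i * F i = 1) ->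
  (\prod_(i | P i) F i) * (\prod_(i | P i) F i) = 1.
Proof. by move=> FF; rewrite -big_split big1 => [|i _] /=; rewrite ?FF. Qed.

Let sqr_row (J : {set 'I_3}) (i : 'I_3) :
  (\prod_(j in J | (j < i)%N) -1) * (\prod_(j in J | (j < i)%N) -1) = 1 :> R.
Proof. by apply: (@sqr_prod _ (fun=> -1)) => _; rewrite mulrNN mulr1. Qed.

Lemma blade_sign_sqr I J : blade_sign I J * blade_sign I J = 1.
Proof. by apply: sqr_prod => i; exact: sqr_row. Qed.

Lemma blade_sign_symdiffl I J K :
  blade_sign (symdiff I J) K = blade_sign I K * blade_sign J K.
Proof. by apply: sign_symdiff => i; exact: sqr_row. Qed.

Lemma blade_sign_symdiffr I J K :
  blade_sign I (symdiff J K) = blade_sign I J * blade_sign I K.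
Proof.
rewrite /blade_sign -big_split; apply: eq_bigr => i _ /=.
rewrite !big_mkcondr; apply: sign_symdiff => j.
by case: ifP => _; rewrite ?mulrNN mulr1.
Qed.

Lemma blade_sign0l J : blade_sign finset.set0 J = 1.
Proof. by rewrite /blade_sign big_set0. Qed.

Lemma blade_sign0r I : blade_sign I finset.set0 = 1.
Proof.
by rewrite /blade_sign big1// => i _; rewrite big_pred0// => j; rewrite inE.
Qed.

Let cl_mulA : associative cl_mul.
Proof.
move=> A B C; apply/ffunP => K; rewrite !ffunE.
under eq_bigr => I _ do rewrite ffunE !mulr_sumr.
under [RHS]eq_bigr => L _ do rewrite ffunE mulr_suml mulr_sumr.
rewrite [RHS]exchange_big; apply: eq_bigr => I _ /=.
rewrite [RHS](reindex_inj (can_inj (symdiffK I))) /=.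
apply: eq_bigr => J _; rewrite symdiffK.
have -> : symdiff J (symdiff I K) = symdiff (symdiff I J) K.
  by rewrite symdiffA (symdiffC J).
rewrite !(blade_sign_symdiffl, blade_sign_symdiffr).
rewrite -[LHS]mul1r -(blade_sign_sqr I J); ring.
Qed.

Let cl_mul1l : left_id (blade finset.set0) cl_mul.
Proof.
move=> A; apply/ffunP => K; rewrite !ffunE (bigD1 finset.set0)//= big1 => [|I nI].
  by rewrite addr0 ffunE eqxx mul1r symdiff0l blade_sign0l mul1r.
by rewrite ffunE (negPf nI) mul0r mulr0.
Qed.

Let cl_mul1r : right_id (blade finset.set0) cl_mul.
Proof.
move=> A; apply/ffunP => K; rewrite !ffunE (bigD1 K)//= big1 => [|I nI].
  by rewrite addr0 ffunE symdiffv eqxx mulr1 blade_sign0r mul1r.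
rewrite ffunE [_ == _](_ : _ = false) ?mulr0//.
apply: contraNF nI => /eqP IK.
by rewrite -(symdiff0l K) -IK -symdiffA symdiffv symdiffC symdiff0l.
Qed.

Let cl_mulDl : left_distributive cl_mul +%R.
Proof.
move=> A B C; apply/ffunP => K; rewrite !ffunE -big_split; apply: eq_bigr => I _.
by rewrite ffunE mulrDl mulrDr.
Qed.

Let cl_mulDr : right_distributive cl_mul +%R.
Proof.
move=> A B C; apply/ffunP => K; rewrite !ffunE -big_split; apply: eq_bigr => I _.
by rewrite ffunE !mulrDr.
Qed.

Let cl_oner_neq0 : blade finset.set0 != 0.
Proof.
apply/eqP => /ffunP /(_ finset.set0); rewrite !ffunE eqxx => /eqP.
by rewrite oner_eq0.
Qed.

HB.instance Definition _ := GRing.Zmodule_isNzRing.Build cl3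
  cl_mulA cl_mul1l cl_mul1r cl_mulDl cl_mulDr cl_oner_neq0.

Let cl_scalerAl (a : R) (A B : cl3) : a *: (A * B) = (a *: A) * B.
Proof.
apply/ffunP => K; rewrite !ffunE /GRing.scale/= mulr_sumr; apply: eq_bigr => I _.
by rewrite ffunE /GRing.scale/=; ring.
Qed.

HB.instance Definition _ := GRing.Lmodule_isLalgebra.Build R cl3 cl_scalerAl.

Let cl_scalerAr (a : R) (A B : cl3) : a *: (A * B) = A * (a *: B).
Proof.
apply/ffunP => K; rewrite !ffunE /GRing.scale/= mulr_sumr; apply: eq_bigr => I _.
by rewrite ffunE /GRing.scale/=; ring.
Qed.

HB.instance Definition _ := GRing.Lalgebra_isAlgebra.Build R cl3 cl_scalerAr.

Lemma cl_mulE (A B : cl3) K : (A * B) K =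
  \sum_I blade_sign I (symdiff I K) * (A I * B (symdiff I K)).
Proof. by rewrite [LHS]ffunE. Qed.

Lemma cl_1E K : (1 : cl3) K = (K == finset.set0)%:R.
Proof. by rewrite [LHS]ffunE. Qed.

Lemma cl_scaleE (a : R) (A : cl3) K : (a *: A) K = a * A K.
Proof. by rewrite [LHS]ffunE. Qed.

Lemma blade_mul I J : blade I * blade J = blade_sign I J *: blade (symdiff I J).
Proof.
apply/ffunP => K; rewrite cl_mulE (bigD1 I)//= big1 => [|L nL]; last first.
  by rewrite ffunE (negPf nL) mul0r mulr0.
rewrite addr0 !ffunE eqxx mul1r /GRing.scale/=.
have -> : (symdiff I K == J) = (K == symdiff I J).
  by apply/eqP/eqP => [<-|->]; rewrite symdiffK.
by case: eqP => [->|_]; rewrite ?symdiffK ?mulr0.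
Qed.

Definition cl_e (i : 'I_3) : cl3 := blade [set i]%SET.

Lemma cl_e_sqr i : cl_e i * cl_e i = 1.
Proof.
rewrite /cl_e blade_mul symdiffv [blade_sign _ _](_ : _ = 1) ?scale1r//.
rewrite /blade_sign big_set1 big_pred0// => j.
by rewrite inE; case: eqP => // ->; rewrite ltnn.
Qed.

Lemma cl_e_anticomm i j : i != j -> cl_e i * cl_e j = - (cl_e j * cl_e i).
Proof.
move=> ij; rewrite /cl_e !blade_mul (symdiffC [set j]%SET) -scaleNr.
suff sE k l : blade_sign [set k]%SET [set l]%SET = if (l < k)%N then -1 else 1.
  rewrite !sE; case: ltngtP => [||/val_inj ij0]; rewrite ?opprK//.
  by rewrite ij0 eqxx in ij.
rewrite /blade_sign big_set1 big_mkcondr big_set1.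
by [].
Qed.

Definition grade (k : nat) (A : cl3) : cl3 := 
  [ffun I : {set 'I_3} => if #|I| == k then A I else 0].

Definition scalar_part (A : cl3) : R := A finset.set0.

Definition reversion (A : cl3) : cl3 :=
  \sum_(k < 4) (-1) ^+ (k * k.-1)./2 *: grade k A.

Definition is_vector (A : cl3) := grade 1 A = A.

Definition is_bivector (A : cl3) := grade 2 A = A.

Definition unit_bivector (P : cl3) := is_bivector P /\ P ^+ 2 = -1.

(* B ^+ 2 is the scalar - ||B||^2 when B is a bivector *)
Definition bivector_norm (B : cl3) : R := Num.sqrt (- scalar_part (B ^+ 2)).

Let blade_sign_comm I J :
  blade_sign I J * blade_sign J I = (-1) ^+ (#|I| * #|J| + #|I :&: J|%SET).
Proof.
rewrite /blade_sign [X in _ * X](exchange_big_dep (fun i => i \in I))/=; last first.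
  by move=> i j _ /andP[].
rewrite -big_split/= exprD mulnC exprM.
have -> : (-1) ^+ #|(I :&: J)%SET| = \prod_(i in I) (if i \in J then -1 else 1) :> R.
  by rewrite -prodr_const -big_mkcondr; apply: eq_bigl => i; rewrite inE.
rewrite -[(_ ^+ #|J|) ^+ #|I|]prodr_const -big_split/=.
apply: eq_bigr => i iI; rewrite -prodr_const !big_mkcondr/=.
rewrite [X in _ * X](_ : _ = \prod_(j in J) if (i < j)%N then -1 else 1); last first.
  by apply: eq_bigr => j _; rewrite iI.
have -> : (if i \in J then -1 else 1) = \prod_(j in J) (if j == i then -1 else 1) :> R.
  by rewrite -big_mkcondr big_mkcond (bigD1 i)//= eqxx andbT big1 ?mulr1// => j /negPf->;
    rewrite andbF.
rewrite -!big_split/=; apply: eq_bigr => j _.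
rewrite -(inj_eq val_inj)/=.
by case: ltngtP; rewrite ?mulr1 ?mul1r ?mulrNN ?mulr1.
Qed.

Let blade_sign_bivector (I : {set 'I_3}) : #|I| = 2%N -> blade_sign I I = -1.
Proof.
move=> /eqP/cards2P[a [b [ab ->]]]; rewrite /blade_sign big_setU1 ?inE//= big_set1.
rewrite !(big_mkcondr _ _ (fun i : 'I_3 => i \in _)) !big_setU1 ?inE//= !big_set1 !ltnn.
move: ab; rewrite -(inj_eq val_inj)/=.
by case: ltngtP; rewrite ?mulr1 ?mul1r.
Qed.

Let sqr_homogeneous k (B : cl3) K : grade k B = B ->
  (forall I J : {set 'I_3}, #|I| = k -> #|J| = k -> I != J ->
     blade_sign J I = - blade_sign I J) ->
  K != finset.set0 -> (B ^+ 2) K = 0.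
Proof.
move=> Bk anti K0.
have B0 (I : {set 'I_3}) : #|I| != k -> B I = 0 by rewrite -Bk ffunE => /negPf ->.
have SN : (B ^+ 2) K = - (B ^+ 2) K; last by apply/eqP; rewrite -eqNr -SN.
rewrite expr2 cl_mulE -sumrN [LHS](reindex_inj (can_inj (symdiffK K))) /=.
apply: eq_bigr => I _; rewrite ![symdiff _ K]symdiffC symdiffK.
set J := symdiff K I.
have [Ik|/B0 ->] := eqVneq #|I| k; last by rewrite !mul0r !mulr0 oppr0.
have [Jk|/B0 ->] := eqVneq #|J| k; last by rewrite !mul0r !mulr0 oppr0.
rewrite anti ?mulNr 1?[B J * _]mulrC//.
by apply: contraNneq K0 => IJ; rewrite -(symdiffv I) {1}IJ /J -symdiffA symdiffv
  symdiffC symdiff0l.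
Qed.

Let scalar_part_sqr k (B : cl3) c : grade k B = B ->
  (forall I : {set 'I_3}, #|I| = k -> blade_sign I I = c) ->
  scalar_part (B ^+ 2) = c * \sum_I B I ^+ 2.
Proof.
move=> Bk sc; rewrite /scalar_part expr2 cl_mulE mulr_sumr; apply: eq_bigr => I _.
rewrite symdiffC symdiff0l; have [/sc->//|Ik] := eqVneq #|I| k.
by rewrite -Bk ffunE (negPf Ik) !(mul0r, mulr0) expr0n mulr0.
Qed.

Let scalarE (A : cl3) : (forall K, K != finset.set0 -> A K = 0) ->
  A = (scalar_part A)%:A.
Proof.
move=> A0; apply/ffunP => K; rewrite cl_scaleE cl_1E.
by have [->|/A0 ->] := eqVneq K finset.set0; rewrite ?mulr1 ?mulr0.
Qed.

Lemma bivector_normP B : is_bivector B ->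
  B ^+ 2 = - (bivector_norm B ^+ 2)%:A /\ 0 <= bivector_norm B.
Proof.
move=> B2; split; last exact: sqrtr_ge0.
rewrite /bivector_norm (scalar_part_sqr B2 blade_sign_bivector) mulN1r opprK.
rewrite sqr_sqrtr; last by apply: sumr_ge0 => I _; exact: sqr_ge0.
rewrite -scaleNr -mulN1r -(scalar_part_sqr B2 blade_sign_bivector).
apply: scalarE => K; apply: (sqr_homogeneous B2) => I J I2 J2 IJ.
have /(congr1 (fun x => blade_sign I J * x)) := blade_sign_comm I J.
rewrite mulrA blade_sign_sqr mul1r I2 J2 => ->.
suff -> : #|(I :&: J)%SET| = 1%N by rewrite -signr_odd/= expr1 mulrN1.
have U3 : (#|(I :|: J)%SET| <= 3)%N.
  by rewrite (leq_trans (max_card _)) ?card_ord.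
have := cardsUI I J; rewrite I2 J2.
have := subset_leq_card (finset.subsetIl I J); rewrite I2.
case IJE : #|(I :&: J)%SET| => [|[|[|k]]]//= _.
  by rewrite addn0 => U4; rewrite U4 in U3.
case/eqP: IJ; transitivity (I :&: J)%SET; [apply/esym|]; apply/eqP.
  by rewrite eqEcard finset.subsetIl I2 IJE.
by rewrite eqEcard finset.subsetIr J2 IJE.
Qed.

Lemma vector_sqrP A : is_vector A ->
  A ^+ 2 = (scalar_part (A ^+ 2))%:A /\ 0 <= scalar_part (A ^+ 2).
Proof.
move=> A1; split.
  apply: scalarE => K; apply: (sqr_homogeneous A1) => I J I1 J1 IJ.
  have /(congr1 (fun x => blade_sign I J * x)) := blade_sign_comm I J.
  rewrite mulrA blade_sign_sqr mul1r I1 J1 => ->.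
  suff -> : #|(I :&: J)%SET| = 0%N by rewrite -signr_odd/= expr1 mulrN1.
  apply/eqP; rewrite cards_eq0; apply/eqP/setP => i; rewrite !inE.
  move/eqP/cards1P: I1 IJ => [a ->]; move/eqP/cards1P: J1 => [b ->].
  rewrite !inE; apply: contraNF => /andP[/eqP <- /eqP <-]//.
rewrite (@scalar_part_sqr _ _ 1 A1) ?mul1r ?sumr_ge0// => [I _|I /eqP/cards1P[a ->]].
  exact: sqr_ge0.
rewrite /blade_sign big_set1 big_pred0// => j.
by rewrite inE; case: eqP => // ->; rewrite ltnn.
Qed.

Lemma reversion_vector A : is_vector A -> reversion A = A.
Proof.
move=> A1; apply/ffunP => I; rewrite /reversion sum_ffunE.
under eq_bigr => k _ do rewrite cl_scaleE ffunE.
have [I1|I1] := eqVneq #|I| 1%N.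
  rewrite !big_ord_recl big_ord0 I1 /= expr0.
  by rewrite !mulr0 add0r !addr0 mul1r.
by rewrite -A1 ffunE (negPf I1) big1// => k _; rewrite if_same mulr0.
Qed.

(* e^(tP), for a unit bivector P *)
Definition cl_exp (t : R) (P : cl3) : cl3 := (cos t)%:A + sin t *: P.

Lemma cl_expE t P K : cl_exp t P K = cos t * (K == finset.set0)%:R + sin t * P K.
Proof. by rewrite [LHS]ffunE !cl_scaleE cl_1E. Qed.

Definition atan2 (y x : R) : R :=
  if 0 < x then atan (y / x)
  else if x < 0 then (if 0 <= y then atan (y / x) + pi else atan (y / x) - pi)
  else Num.sg y * (pi / 2).

Definition cl_arg (C : cl3) : R :=
  atan2 (bivector_norm (grade 2 C)) (scalar_part C).

(* C = r e^(phi Q) is the polar form of C; Q is any unit bivector when the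
   bivector part of C vanishes *)
Definition polar_form (C : cl3) (r phi : R) (Q : cl3) :=
  [/\ 0 <= r, C = r *: cl_exp phi Q, phi = cl_arg C, unit_bivector Q &
      grade 2 C != 0 -> Q = (bivector_norm (grade 2 C))^-1 *: grade 2 C].


End clifford_algebra.

Section lebesgue_measure_tuple.
Variable R : realType.
Local Notation mR := (measurableTypeR R).
Local Open Scope ereal_scope.

Definition tuple_cons (m : nat) (p : mR * m.-tuple mR) : m.+1.-tuple mR :=
  [tuple of p.1 :: p.2].

(* The Lebesgue measure on the Borel sets of R^m, as an iterated product; see
   lebesgue_tuple_box *)
Fixpoint lebesgue_tuple (m : nat) : set (m.-tuple mR) -> \bar R :=
  match m with
  | 0 => dirac [tuple]
  | m'.+1 => pushforward (@lebesgue_measure R \x @lebesgue_tuple m') (@tuple_cons m')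
  end.

Let measurable_tuple_cons m : measurable_fun [set: mR * m.-tuple mR] (@tuple_cons m).
Proof. exact: measurable_cons. Qed.

Let tuple_uncons m (t : m.+1.-tuple mR) : mR * m.-tuple mR :=
  (thead t, [tuple of behead t]).

Let measurable_tuple_uncons m : measurable_fun [set: m.+1.-tuple mR] (@tuple_uncons m).
Proof.
apply/measurable_fun_pairP; split; first exact: measurable_tnth.
exact: measurable_behead.
Qed.

Let tuple_consK m : cancel (@tuple_cons m) (@tuple_uncons m).
Proof. by move=> [x t]; rewrite /tuple_uncons /=; congr pair; apply: val_inj. Qed.

Section push.
Variables (m : nat) (mu : {sigma_finite_measure set (m.-tuple mR) -> \bar R}).
Definition tuple_push := pushforward (@lebesgue_measure R \x mu) (@tuple_cons m).

Let tuple_push0 : tuple_push set0 = 0.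
Proof. by rewrite /tuple_push /pushforward preimage_set0 measure0. Qed.

Let tuple_push_ge0 A : 0 <= tuple_push A. Proof. exact: (@measure_ge0 _ _ _ (@lebesgue_measure R \x mu)). Qed.

Let mpreimage A : measurable A -> measurable (@tuple_cons m @^-1` A).
Proof. by move=> mA; rewrite -[X in measurable X]setTI; exact: measurable_tuple_cons. Qed.

Let tuple_push_sigma_additive : semi_sigma_additive tuple_push.
Proof.
move=> F mF tF mUF; rewrite /tuple_push /pushforward preimage_bigcup.
apply: measure_semi_sigma_additive.
- by move=> n; exact: mpreimage.
- apply/trivIsetP => /= i j _ _ ij; rewrite -preimage_setI.
  by move/trivIsetP : tF => /(_ _ _ _ _ ij) ->//; rewrite preimage_set0.
- by rewrite -preimage_bigcup; exact: mpreimage.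
Qed.

HB.instance Definition _ := isMeasure.Build _ _ _ tuple_push
  tuple_push0 tuple_push_ge0 tuple_push_sigma_additive.

Let tuple_push_sigma_finite : sigma_finite [set: m.+1.-tuple mR] tuple_push.
Proof.
have /sigma_finiteP[F [UF ndF Foo]] := sigma_finiteT (@lebesgue_measure R).
have /sigma_finiteP[G [UG ndG Goo]] := sigma_finiteT mu.
exists (fun n => @tuple_uncons m @^-1` (F n `*` G n)).
  rewrite -preimage_bigcup (_ : \bigcup_n _ = setT) ?preimage_setT//.
  apply/seteqP; split => // -[x t] _.
  have [i _ Fix] : (\bigcup_i F i) x by rewrite -UF.
  have [j _ Gjt] : (\bigcup_i G i) t by rewrite -UG.
  exists (maxn i j) => //; split => /=.
    by move: x Fix; exact/subsetPset/ndF/leq_maxl.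
  by move: t Gjt; exact/subsetPset/ndG/leq_maxr.
move=> n; have [mF Fn] := Foo n; have [mG Gn] := Goo n; split.
  rewrite -[X in measurable X]setTI; apply: measurable_tuple_uncons => //.
  exact: measurableX.
rewrite /tuple_push /pushforward -comp_preimage.
rewrite (_ : _ \o _ = id); last by apply/funext => p /=; exact: tuple_consK.
by rewrite preimage_id product_measure1E// lte_mul_pinfty// ge0_fin_numE.
Qed.

HB.instance Definition _ := Measure_isSigmaFinite.Build _ _ _ tuple_push
  tuple_push_sigma_finite.
End push.

Let lebesgue_tupleE m :
  {mu : {sigma_finite_measure set (m.-tuple mR) -> \bar R} |
    mu = @lebesgue_tuple m :> (set _ -> _)}.
Proof.
elim: m => [|m [mu muE]] /=; first by exists (dirac [tuple]).
by exists (tuple_push mu); rewrite -muE.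
Qed.

Section instances.
Variable m : nat.

Let mu0 : @lebesgue_tuple m set0 = 0.
Proof. by have [mu <-] := lebesgue_tupleE m. Qed.

Let mu_ge0 A : 0 <= @lebesgue_tuple m A.
Proof. by have [mu <-] := lebesgue_tupleE m. Qed.

Let mu_sigma_additive : semi_sigma_additive (@lebesgue_tuple m).
Proof. by have [mu <-] := lebesgue_tupleE m; exact: measure_semi_sigma_additive. Qed.

HB.instance Definition _ := isMeasure.Build _ _ _ (@lebesgue_tuple m)
  mu0 mu_ge0 mu_sigma_additive.

Let mu_sigma_finite : sigma_finite [set: m.-tuple mR] (@lebesgue_tuple m).
Proof. by have [mu <-] := lebesgue_tupleE m; exact: sigma_finiteT. Qed.

HB.instance Definition _ := Measure_isSigmaFinite.Build _ _ _ (@lebesgue_tuple m)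
  mu_sigma_finite.
End instances.

Lemma lebesgue_tuple_box m (A : 'I_m -> set mR) : (forall i, measurable (A i)) ->
  @lebesgue_tuple m [set t | forall i, A i (tnth t i)] =
  \prod_(i < m) lebesgue_measure (A i).
Proof.
elim: m A => [|m IHm] A mA /=.
  rewrite big_ord0 diracE mem_set//= => -[]//.
rewrite big_ord_recl -IHm // -product_measure1E//; last first.
  rewrite [X in measurable X](_ : _ =
      \bigcap_(i in [set: 'I_m]) ((fun t => tnth t i) @^-1` A (lift ord0 i))).
    apply: fin_bigcap_measurable => // i _.
    by rewrite -[X in measurable X]setTI; exact: measurable_tnth.
  by apply/seteqP; split => [t At i _|t At i]; exact: At.
apply: (congr1 (product_measure1 _ _)); apply/seteqP; split => -[x t] /=.
  move=> At; split; first by have := At ord0.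
  by move=> i; have := At (lift ord0 i); rewrite tnthS.
move=> [Ax At] i; case: (unliftP ord0 i) => [j ->|->]//.
by rewrite tnthS.
Qed.

End lebesgue_measure_tuple.

Section vector_fields.
Variables (R : realType) (m : nat).
Local Notation Rm := (m.-tuple (measurableTypeR R)).
Local Notation mu := (@lebesgue_tuple R m).
Implicit Types (A B v : Rm -> cl3 R) (P : cl3 R).

Definition addt (x y : Rm) : Rm := [tuple tnth x i + tnth y i | i < m].

Definition outer_rotation P (alpha : R) v : Rm -> cl3 R :=
  fun x => cl_exp (- (alpha / 2)) P * v x * cl_exp (alpha / 2) P.

(* ||v||^2, with value in [0, +oo]: v(x)^2 is a scalar for a vector field v *)
Definition sqr_norm v : \bar R := (\int[mu]_x (scalar_part (v x ^+ 2))%:E)%E.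

Definition norm2 v : R := Num.sqrt (fine (sqr_norm v)).

Definition L2_vector_field v :=
  [/\ forall x, is_vector (v x),
      forall I, measurable_fun [set: Rm] (fun x => v x I) &
      (sqr_norm v < +oo)%E].

Definition cl_integral A : cl3 R :=
  [ffun I => \int[mu]_(x in [set: Rm]) A x I].

Definition cross_correlation A B (x : Rm) : cl3 R :=
  cl_integral (fun y => reversion (A y) * B (addt y x)).

Definition normalized_correlation P alpha v : cl3 R :=
  (norm2 (outer_rotation P alpha v) * norm2 v)^-1 *:
    cross_correlation (outer_rotation P alpha v) v [tuple 0 | _ < m].

(* When v is (almost everywhere) normal to the plane of P, the rotations in that
   plane do not move v. The map beta is then the identity, so that its iterates
   do not tend to 0: such fields have to be excluded from the convergence
   theorem. *)
Definition rotation_invariant P v :=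
  forall t, {ae mu, forall x, outer_rotation P t v x = v x}.

Lemma rotation_invariant_beta P v (alpha phi r : R) (Q : cl3 R) :
  L2_vector_field v -> norm2 v != 0 -> unit_bivector P -> 0 <= alpha < pi ->
  (forall x, outer_rotation P alpha v x = v x) ->
  polar_form (normalized_correlation P alpha v) r phi Q ->
  2 * cl_arg (cl_exp (alpha / 2) P * cl_exp (phi / 2) Q) = alpha.
Proof.
move=> [v1 _ _] v0 [P2 PP] /andP[a0 api] Rv [_ _ phiE _ _].
have rE : outer_rotation P alpha v = v by apply/funext.
have addt0 y : addt y [tuple 0 | _ < m] = y.
  by apply: eq_from_tnth => i; rewrite !tnth_mktuple addr0.
have CE : normalized_correlation P alpha v = 1.
  rewrite /normalized_correlation rE.
  have -> : cross_correlation v v [tuple 0 | _ < m] = (norm2 v ^+ 2)%:A.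
    apply/ffunP => K; rewrite cl_scaleE cl_1E ffunE.
    rewrite /Rintegral; under eq_integral => x _.
      rewrite addt0 reversion_vector// -expr2 (vector_sqrP (v1 x)).1.
      rewrite cl_scaleE cl_1E.
      over.
    have [_|_] := eqVneq K finset.set0; last first.
      by under eq_integral do rewrite mulr0; rewrite integral0 mulr0.
    under eq_integral do rewrite mulr1.
    rewrite mulr1 sqr_sqrtr// fine_ge0// integral_ge0// => x _.
    by rewrite lee_fin (vector_sqrP (v1 x)).2.
  by rewrite scalerA expr2 mulVf ?scale1r// mulf_neq0.
have phi0 : phi = 0.
  rewrite phiE CE /cl_arg.
  have -> : grade 2 (1 : cl3 R) = 0.
    apply/ffunP => I; rewrite ffunE [RHS]ffunE cl_1E.
    by have [->|_] := eqVneq I finset.set0; rewrite ?cards0 ?if_same.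
  rewrite /bivector_norm expr0n /= /scalar_part ffunE oppr0 sqrtr0 cl_1E eqxx.
  by rewrite /atan2 ltr01 mul0r atan0.
rewrite phi0 mul0r /(cl_exp 0) cos0 sin0 scale1r scale0r addr0 mulr1.
have sc : 0 < cos (alpha / 2) by rewrite cos_gt0_pihalf//; lra.
have ss : 0 <= sin (alpha / 2) by rewrite sin_ge0_pi//; lra.
have P0 : scalar_part P = 0 by rewrite /scalar_part -P2 ffunE cards0.
have gP : grade 2 (cl_exp (alpha / 2) P) = sin (alpha / 2) *: P.
  apply/ffunP => I; rewrite -[in RHS]P2 ffunE cl_scaleE cl_expE [grade 2 P I]ffunE.
  have [I2|_] := eqVneq #|I| 2%N; last by rewrite mulr0.
  have [I0|_] := eqVneq I finset.set0; first by rewrite I0 cards0 in I2.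
  by rewrite mulr0 add0r.
rewrite /cl_arg gP /bivector_norm exprZn PP.
have -> : scalar_part (sin (alpha / 2) ^+ 2 *: (-1 : cl3 R)) = - sin (alpha / 2) ^+ 2.
  by rewrite /scalar_part cl_scaleE ffunE cl_1E eqxx mulrN1.
have -> : scalar_part (cl_exp (alpha / 2) P) = cos (alpha / 2).
  by rewrite /scalar_part cl_expE -/(scalar_part P) P0 eqxx mulr1 mulr0 addr0.
rewrite opprK sqrtr_sqr ger0_norm// /atan2 sc.
by rewrite -/(tan _) tanK ?in_itv/=; lra.
Qed.

End vector_fields.

(* Main.v *)
Require Import Defs.
From HB Require Import structures.
From mathcomp Require Import all_boot all_order all_algebra.
From mathcomp Require Import all_classical all_reals all_analysis.
From mathcomp Require Import measurable_realfun ring lra.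
Import Order.TTheory GRing.Theory Num.Theory.
Import numFieldNormedType.Exports.

(** Write c = cos (alpha/2), s = sin (alpha/2), u for the rotated field
    e^(-(alpha/2) P) v e^((alpha/2) P), and G = r e^(phi Q) for the normalized
    correlation, which is the integral of u v divided by ||v||^2. Three
    properties of G carry the proof.

    - The half rotation e^((alpha/2) P) cancels the left factor of u, so that the
      scalar part of e^((alpha/2) P) G is the mean of <v e^((alpha/2) P) v>, and
      this equals c ([normalized_correlation_half_rotation]).
    - r <= 1: rotors preserve the Euclidean norm on the algebra, and r is the
      scalar part of the rotor e^(-phi Q) applied to G
      ([normalized_correlation_rotor_le]).
    - 1 - <G>_0 = k s^2, where k depends on v and P only, and k > 0 unless v
      commutes with P almost everywhere, that is, unless the rotations in the
      plane of P fix v ([normalized_correlation_scalar_part],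
      [normalized_correlation_pi_lt1]).

    The rotor e^((phi/2) Q) is proportional to r + G, with
    2 cos (phi/2) r e^((phi/2) Q) = r + G ([polar_form_half]). Multiplying by
    e^((alpha/2) P) and taking scalar parts, D = <e^((alpha/2) P) e^((phi/2) Q)>_0
    satisfies 2 cos (phi/2) r D = c (1 + r), whereas r + <G>_0 =
    2 r cos^2 (phi/2). Eliminating cos (phi/2) yields
<<
      D^2 = c^2 (1 + r)^2 / (2 r (r + <G>_0)),
>>
    and D^2 (1 - k s^2 / 2) >= c^2 follows from r <= 1 ([half_angle_estimate]).
    As D <= cos (beta(alpha)/2), this bounds beta(alpha) by alpha, with a
    quantitative gain: the iterates decrease, and their limit l satisfies
    cos^2 (l/2) (1 - k sin^2 (l/2) / 2) >= cos^2 (l/2), which forces l = 0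
    ([iter_half_angle_cvg0]). The explicit gain takes the place of the continuity
    of beta at l. *)

Set Implicit Arguments.
Unset Strict Implicit.
Unset Printing Implicit Defensive.

Local Open Scope classical_set_scope.
Local Open Scope ring_scope.

(** * Reversion and the Euclidean norm on the Clifford algebra *)

Section clifford_algebra.
Variable R : realType.
Implicit Types (A B C P Q v : cl3 R) (t s : R).

Lemma scalar_partD A B : scalar_part (A + B) = scalar_part A + scalar_part B.
Proof. by rewrite /scalar_part ffunE. Qed.

Lemma scalar_partN A : scalar_part (- A) = - scalar_part A.
Proof. by rewrite /scalar_part ffunE. Qed.

Lemma scalar_partB A B : scalar_part (A - B) = scalar_part A - scalar_part B.
Proof. by rewrite scalar_partD scalar_partN. Qed.

Lemma scalar_partZ t A : scalar_part (t *: A) = t * scalar_part A.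
Proof. by rewrite /scalar_part cl_scaleE. Qed.

Lemma scalar_part_alg t : scalar_part (t%:A : cl3 R) = t.
Proof. by rewrite scalar_partZ /scalar_part cl_1E eqxx mulr1. Qed.

Lemma scalar_partM A B :
  scalar_part (A * B) = \sum_I blade_sign R I I * (A I * B I).
Proof.
rewrite /scalar_part cl_mulE; apply: eq_bigr => I _.
by rewrite symdiffC symdiff0l.
Qed.

Lemma scalar_partMC A B : scalar_part (A * B) = scalar_part (B * A).
Proof.
by rewrite !scalar_partM; apply: eq_bigr => I _; rewrite [A I * _]mulrC.
Qed.

(** Squaring a blade costs the transpositions that reverse its factors, so that
    the sign of reversion in grade k is the sign of e_I e_I, for #|I| = k. In
    this form reversion is governed by the bilinearity of [blade_sign]. *)
Lemma reversionE A I : reversion A I = blade_sign R I I * A I.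
Proof.
rewrite /reversion sum_ffunE.
under eq_bigr => k _ do rewrite cl_scaleE ffunE.
have I3 : (#|I| < 4)%N by rewrite ltnS (leq_trans (max_card _))// card_ord.
rewrite (bigD1 (Ordinal I3))//= eqxx big1 ?addr0 => [|k kI]; last first.
  rewrite ifF ?mulr0//; apply: contraNF kI => /eqP Ik.
  by apply/eqP/val_inj; rewrite /= Ik.
congr (_ * _); rewrite /blade_sign.
under eq_bigr => i _ do rewrite big_mkcondr big_mkcond !big_ord_recl big_ord0.
rewrite big_mkcond !big_ord_recl big_ord0 -sum1_card big_mkcond.
rewrite !big_ord_recl big_ord0 /=.
by do 3![case: ifP => _ /=]; rewrite /= ?(expr0, expr1, mulr1, mul1r, mulrNN)//;
  lra.
Qed.

Lemma reversionM A B : reversion (A * B) = reversion B * reversion A.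
Proof.
apply/ffunP => K; rewrite reversionE !cl_mulE mulr_sumr.
rewrite [RHS](reindex_inj (can_inj (symdiffK K))) /=; apply: eq_bigr => I _.
rewrite !reversionE ![symdiff _ K]symdiffC symdiffK.
rewrite !(blade_sign_symdiffl, blade_sign_symdiffr).
rewrite -[LHS]mul1r -[1 * _]mul1r -{1}(blade_sign_sqr R K I) -(blade_sign_sqr R I I).
by ring.
Qed.

Lemma reversionZ t A : reversion (t *: A) = t *: reversion A.
Proof. by apply/ffunP => I; rewrite cl_scaleE !reversionE cl_scaleE mulrCA. Qed.

Lemma reversionD A B : reversion (A + B) = reversion A + reversion B.
Proof.
by apply/ffunP => I; rewrite [RHS]ffunE !reversionE ffunE mulrDr.
Qed.

Lemma reversionN A : reversion (- A) = - reversion A.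
Proof. by rewrite -scaleN1r reversionZ scaleN1r. Qed.

Lemma reversion1 : reversion (1 : cl3 R) = 1.
Proof.
apply/ffunP => I; rewrite reversionE cl_1E.
by have [->|_] := eqVneq I finset.set0; rewrite ?blade_sign0l ?mul1r ?mulr0.
Qed.

Lemma reversion_bivector B : is_bivector B -> reversion B = - B.
Proof.
move=> B2; apply/ffunP => I; rewrite /reversion sum_ffunE [RHS]ffunE.
under eq_bigr => k _ do rewrite cl_scaleE ffunE.
have [I2|I2] := eqVneq #|I| 2%N.
  by rewrite !big_ord_recl big_ord0 I2 /= expr1 !mulr0 !add0r !addr0 mulN1r.
by rewrite -B2 ffunE (negPf I2) oppr0 big1// => k _; rewrite if_same mulr0.
Qed.

(** The Euclidean norm on the eight coefficients. Written with the reversion,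
    it becomes accessible to algebra in the form <rev(AB) AB> =
    <rev(B) rev(A) A B>. *)
Definition cl_sqnorm A : R := scalar_part (reversion A * A).

Lemma cl_sqnormE A : cl_sqnorm A = \sum_I A I ^+ 2.
Proof.
rewrite /cl_sqnorm scalar_partM; apply: eq_bigr => I _.
by rewrite reversionE !mulrA blade_sign_sqr mul1r.
Qed.

Lemma cl_sqnorm_ge0 A : 0 <= cl_sqnorm A.
Proof. by rewrite cl_sqnormE sumr_ge0// => I _; exact: sqr_ge0. Qed.

Lemma cl_sqnorm_coef A I : A I ^+ 2 <= cl_sqnorm A.
Proof.
rewrite cl_sqnormE (bigD1 I)//= lerDl sumr_ge0// => J _; exact: sqr_ge0.
Qed.

Lemma cl_sqnorm_eq0 A : cl_sqnorm A = 0 -> A = 0.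
Proof.
move=> A0; apply/ffunP => I; rewrite [RHS]ffunE; apply/eqP.
by rewrite -sqrf_eq0 eq_le sqr_ge0 andbT -A0 cl_sqnorm_coef.
Qed.

Lemma cl_sqnormZ t A : cl_sqnorm (t *: A) = t ^+ 2 * cl_sqnorm A.
Proof.
by rewrite /cl_sqnorm reversionZ -scalerAl -scalerAr scalerA scalar_partZ -expr2.
Qed.

Lemma cl_sqnormMl A B : reversion A * A = 1 -> cl_sqnorm (A * B) = cl_sqnorm B.
Proof.
by move=> A1; rewrite /cl_sqnorm reversionM -mulrA [_ * (A * B)]mulrA A1 mul1r.
Qed.

(** Expanding 0 <= cl_sqnorm (A - B) with this polarization identity gives the
    Cauchy-Schwarz bound in the additive form [scalar_part_le], which survives
    integration. *)
Lemma cl_sqnormB A B : cl_sqnorm (A - B) =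
  cl_sqnorm A + cl_sqnorm B - 2 * scalar_part (reversion B * A).
Proof.
have AB : scalar_part (reversion A * B) = scalar_part (reversion B * A).
  rewrite !scalar_partM; apply: eq_bigr => I _; rewrite !reversionE; ring.
rewrite /cl_sqnorm reversionD reversionN mulrBr !mulrBl.
rewrite !scalar_partB AB; ring.
Qed.

Lemma scalar_part_le A B :
  2 * scalar_part (reversion B * A) <= cl_sqnorm A + cl_sqnorm B.
Proof. by rewrite -subr_ge0 -cl_sqnormB cl_sqnorm_ge0. Qed.

Lemma scalar_bivector_sqr_le A :
  scalar_part A ^+ 2 + cl_sqnorm (grade 2 A) <= cl_sqnorm A.
Proof.
rewrite !cl_sqnormE [leRHS](bigD1 finset.set0)//= lerD2l.
rewrite (bigD1 finset.set0)//= ffunE cards0 /= expr0n add0r.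
apply: ler_sum => I _; rewrite ffunE; case: ifP => // _.
by rewrite expr0n sqr_ge0.
Qed.

Lemma bivector_norm_sqr B : is_bivector B -> bivector_norm B ^+ 2 = cl_sqnorm B.
Proof.
move=> B2; rewrite sqr_sqrtr /cl_sqnorm; last first.
  rewrite -scalar_partN expr2 -mulNr -reversion_bivector//; exact: cl_sqnorm_ge0.
by rewrite -scalar_partN expr2 -mulNr -reversion_bivector.
Qed.

Lemma grade_is_bivector A : is_bivector (grade 2 A).
Proof. by apply/ffunP => I; rewrite !ffunE; case: eqP. Qed.

(** * Rotors *)
Section exponential.
Variable P : cl3 R.
Hypothesis P_unit : unit_bivector P.

Lemma scalar_part_exp t : scalar_part (cl_exp t P) = cos t.
Proof.
have [P2 _] := P_unit; rewrite /scalar_part cl_expE eqxx mulr1.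
by rewrite -P2 ffunE cards0 mulr0 addr0.
Qed.

Lemma cl_expD t s : cl_exp (t + s) P = cl_exp t P * cl_exp s P.
Proof.
have [_ PP] := P_unit.
rewrite /cl_exp cosD sinD !mulrDl !mulrDr -!scalerAl -!scalerAr !mul1r mulr1.
rewrite -expr2 PP !scalerA scalerN.
by apply/ffunP => K; rewrite !ffunE /GRing.scale /=; ring.
Qed.

Lemma cl_exp0 : cl_exp 0 P = 1.
Proof. by rewrite /cl_exp cos0 sin0 scale1r scale0r addr0. Qed.

Lemma cl_expNl t : cl_exp (- t) P * cl_exp t P = 1.
Proof. by rewrite -cl_expD addNr cl_exp0. Qed.

Lemma cl_expNr t : cl_exp t P * cl_exp (- t) P = 1.
Proof. by rewrite -cl_expD subrr cl_exp0. Qed.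

Lemma reversion_exp t : reversion (cl_exp t P) = cl_exp (- t) P.
Proof.
have [P2 _] := P_unit.
rewrite /cl_exp reversionD !reversionZ reversion1 reversion_bivector//.
by rewrite cosN sinN scaleNr scalerN.
Qed.

Lemma cl_sqnorm_expMl t A : cl_sqnorm (cl_exp t P * A) = cl_sqnorm A.
Proof. by rewrite cl_sqnormMl// reversion_exp cl_expNl. Qed.

End exponential.
End clifford_algebra.

(** * Polar forms and half angles *)

Section half_angles.
Variable R : realType.
Implicit Types (C D P Q : cl3 R).

Lemma atan2_ge0_pi (x y : R) : 0 <= y -> 0 <= atan2 y x <= pi.
Proof.
move=> y0; have p0 := pi_gt0 R; rewrite /atan2 y0.
have [x0|x0|_] := ltrgtP 0 x.
- have := le_atan (divr_ge0 y0 (ltW x0)); rewrite atan0 => ->/=.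
  have := atan_ltpi2 (y / x); lra.
- have : y / x <= 0 by rewrite mulr_ge0_le0// invr_le0 ltW.
  move=> /le_atan; rewrite atan0 => yx; have := atan_gtNpi2 (y / x); lra.
- by case: sgrP y0 => // _ _; lra.
Qed.

Lemma cl_arg_ge0_pi C : 0 <= cl_arg C <= pi.
Proof. by apply: atan2_ge0_pi; exact: sqrtr_ge0. Qed.

(** For x = <D>_0 and y = ||<D>_2||, cos (atan (y / x)) = x / sqrt (x^2 + y^2),
    and x^2 + y^2 is part of the sum of squares that makes up cl_sqnorm D. *)
Lemma cl_arg_acute D : cl_sqnorm D = 1 -> 0 < scalar_part D ->
  cl_arg D < pi / 2 /\ scalar_part D <= cos (cl_arg D).
Proof.
move=> D1 D0; rewrite /cl_arg /atan2 D0; split; first exact: atan_ltpi2.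
have := scalar_bivector_sqr_le D.
rewrite D1 -(bivector_norm_sqr (grade_is_bivector D)).
set y := bivector_norm _; set x := scalar_part D in D0 * => xy.
have xV0 : 0 < x^-1 by rewrite invr_gt0.
have sq0 : 0 < 1 + (y / x) ^+ 2 by rewrite ltr_pwDl// sqr_ge0.
rewrite cos_atan -[leLHS]invrK lef_pV2 ?posrE ?sqrtr_gt0//.
rewrite -[leRHS]gtr0_norm// -sqrtr_sqr ler_sqrt ?sqr_ge0//.
rewrite -(ler_pM2r (exprn_gt0 2 D0)) exprVn mulVf ?expf_neq0 ?gt_eqF//.
by rewrite mulrDl mul1r expr_div_n divfK// expf_neq0// gt_eqF.
Qed.

Section polar_form.
Variables (C : cl3 R) (r phi : R) (Q : cl3 R).
Hypothesis CrQ : polar_form C r phi Q.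

Lemma polar_form_cos_half_ge0 : 0 <= cos (phi / 2).
Proof.
have [_ _ -> _ _] := CrQ; have := cl_arg_ge0_pi C; have := pi_gt0 R => p0 /andP[a0 a1].
by apply: cos_ge0_pihalf; lra.
Qed.

Lemma polar_form_modulus : r = scalar_part (cl_exp (- phi) Q * C).
Proof.
have [_ -> _ uQ _] := CrQ.
by rewrite -scalerAr scalar_partZ cl_expNl// -[1]scale1r scalar_part_alg mulr1.
Qed.

Lemma polar_form_scalar_part : r + scalar_part C = 2 * r * cos (phi / 2) ^+ 2.
Proof.
have [_ -> _ uQ _] := CrQ; rewrite scalar_partZ scalar_part_exp//.
have -> : phi = (phi / 2) *+ 2 by rewrite -mulr_natr divfK.
rewrite cos_mulr2n -[in LHS]mulr_natr -[in RHS](mulr_natr (phi / 2)) divfK//.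
by rewrite mulr2n; ring.
Qed.

(** The rotor with half the angle of C bisects 1 and e^(phi Q): it is
    proportional to r + C, which is linear in C. *)
Lemma polar_form_half : (2 * cos (phi / 2) * r) *: cl_exp (phi / 2) Q = r%:A + C.
Proof.
have [_ -> _ uQ _] := CrQ.
have {3}-> : phi = phi / 2 + phi / 2 by rewrite -splitr.
rewrite cl_expD//; set h := phi / 2.
transitivity (r *: ((cl_exp (- h) Q + cl_exp h Q) * cl_exp h Q)).
  have -> : cl_exp (- h) Q + cl_exp h Q = (2 * cos h)%:A.
    by rewrite /cl_exp cosN sinN; apply/ffunP => K; rewrite !ffunE /GRing.scale/=; ring.
  by rewrite mulr_algl scalerA mulrC.
by rewrite mulrDl cl_expNl// scalerDr.
Qed.

End polar_form.

(** With c = cos (alpha/2), h = cos (phi/2), g the scalar part of the correlation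
    and D that of the product of the half-angle rotors, the two equations hold by
    [polar_form_scalar_part] and [polar_form_half]. They exclude h r = 0, so that
    the inequality can be multiplied by 4 h^2 r^2; it then no longer contains D
    and is a polynomial inequality in r and g. *)
Lemma half_angle_estimate (c h r g D : R) : 0 < c -> 0 <= h -> 0 <= r <= 1 -> g <= 1 ->
  r + g = 2 * r * h ^+ 2 -> 2 * h * r * D = c * (1 + r) ->
  0 < D /\ c ^+ 2 <= D ^+ 2 * (1 - (1 - g) / 2).
Proof.
move=> c0 h0 /andP[r0 r1] g1 rg hrD.
have hrD_gt0 : 0 < 2 * h * r * D by rewrite hrD mulr_gt0//; lra.
have hr0 : 0 <= h * r by rewrite mulr_ge0.
have {}hr0 : 0 < h * r.
  rewrite lt_neqAle hr0 andbT eq_sym; apply: contraTneq hrD_gt0 => hr.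
  by rewrite -(mulrA 2) hr mulr0 mul0r ltxx.
have D0 : 0 < D by move: hrD_gt0; rewrite -(mulrA 2) pmulr_rgt0//; lra.
split=> //.
have hr2 : 0 < 4 * (h * r) ^+ 2 by rewrite mulr_gt0// exprn_gt0.
(* After the substitutions the claim is
   2 r (r + g) <= (1 + r)^2 (1 - (1 - g) / 2). The difference of its two sides
   has the factor 1 - r, and the cofactor is nonnegative as 1 - g <= 1 + r. *)
rewrite -(ler_pM2l hr2).
have -> : 4 * (h * r) ^+ 2 * (D ^+ 2 * (1 - (1 - g) / 2)) =
    c ^+ 2 * ((1 + r) ^+ 2 * (1 - (1 - g) / 2)).
  rewrite mulrA [RHS]mulrA -exprMn -hrD; by field.
have -> : 4 * (h * r) ^+ 2 * c ^+ 2 = c ^+ 2 * (2 * r * (r + g)) by rewrite rg; ring.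
rewrite ler_pM2l ?exprn_gt0// -subr_ge0.
have -> : (1 + r) ^+ 2 * (1 - (1 - g) / 2) - 2 * r * (r + g) =
    (1 - r) * ((1 + r) - (1 - g) * (1 - r) / 2) by field.
have rg0 : 0 <= r + g by rewrite rg !mulr_ge0// exprn_ge0.
rewrite mulr_ge0 ?subr_ge0// ler_pdivrMr//.
apply: (@le_trans _ _ ((1 + r) * 1)); first by rewrite ler_pM//; lra.
lra.
Qed.

(** The second hypothesis gives beta a <= a, so the iterates decrease to a limit
    l < pi. It passes to the limit because both of its sides depend continuously
    on the pair (a, beta a), and for beta a = a = l it says sin (l / 2) = 0. *)
Lemma iter_half_angle_cvg0 (beta : R -> R) (k : R) : 0 < k ->
  (forall a : R, 0 <= a < pi -> 0 <= beta a < pi) ->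
  (forall a : R, 0 <= a < pi ->
     cos (a / 2) ^+ 2 <= cos (beta a / 2) ^+ 2 * (1 - k * sin (a / 2) ^+ 2 / 2)) ->
  forall a : R, 0 <= a < pi -> iter n beta a @[n --> \oo] --> (0 : R).
Proof.
move=> k0 bP bE a aP; have p0 := pi_gt0 R.
set u := fun n => iter n beta a.
have uP n : 0 <= u n < pi by elim: n => [//|n IHn]; exact: bP.
have cos_half (x : R) : 0 <= x < pi -> 0 < cos (x / 2).
  by move=> /andP[x0 xp]; apply: cos_gt0_pihalf; lra.
have du : nonincreasing_seq u.
  apply/nonincreasing_seqP => n.
  have n0 := uP n; have n1 := uP n.+1.
  have : cos (u n / 2) <= cos (u n.+1 / 2).
    have c0 := ltW (cos_half _ n0); have c1 := ltW (cos_half _ n1).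
    rewrite -ler_sqr//.
    apply: (le_trans (bE _ n0)); rewrite ler_piMr ?sqr_ge0//.
    rewrite gerBl divr_ge0// mulr_ge0// ?sqr_ge0//; exact: ltW.
  apply: contraTT; rewrite -!ltNge => un.
  have half_itv (x : R) : 0 <= x < pi -> x / 2 \in `[0, pi].
    by move=> /andP[? ?]; rewrite in_itv/=; apply/andP; split; lra.
  by rewrite ltr_cos ?half_itv// ltr_pM2r.
have lu : has_lbound (range u).
  by exists 0 => _ [n _ <-]; have /andP[] := uP n.
have ul := nonincreasing_cvgn du lu.
move: ul; set l := inf _ => ul.
have ul' : (fun n => u n.+1) n @[n --> \oo] --> l.
  by rewrite (_ : (fun n => u n.+1) = [sequence u (n + 1)%N]_n) ?cvg_shiftn//;
    apply/funext => n; rewrite /= addn1.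
have uc : cvgn u by apply/cvg_ex; exists l.
have l0 : 0 <= l.
  rewrite -(cvg_lim _ ul)//; apply: limr_ge => //.
  by apply: nearW => n; have /andP[] := uP n.
have lp : l < pi.
  have la : l <= a.
    rewrite -(cvg_lim _ ul)//; apply: limr_le => //.
    apply: nearW => n; exact: (du 0%N n (leq0n n)).
  by apply: (le_lt_trans la); have /andP[] := aP.
have half_cvg (w : nat -> R) : w n @[n --> \oo] --> l -> (w n / 2) @[n --> \oo] --> l / 2.
  by move=> wl; apply: cvgMl.
have cosl (w : nat -> R) : w n @[n --> \oo] --> l ->
    cos (w n / 2) ^+ 2 @[n --> \oo] --> cos (l / 2) ^+ 2.
  move=> wl; rewrite expr2; under eq_fun => n do rewrite expr2.
  have h : cos (w n / 2) @[n --> \oo] --> cos (l / 2).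
    by apply: (continuous_cvg _ (@continuous_cos R _)); exact: half_cvg.
  exact: cvgM.
have limE : cos (l / 2) ^+ 2 <=
    cos (l / 2) ^+ 2 * (1 - k * (1 - cos (l / 2) ^+ 2) / 2).
  have c1 := cosl _ ul; have c2 := cosl _ ul'.
  have c3 : (cos (u n.+1 / 2) ^+ 2 * (1 - k * (1 - cos (u n / 2) ^+ 2) / 2))
      @[n --> \oo] --> cos (l / 2) ^+ 2 * (1 - k * (1 - cos (l / 2) ^+ 2) / 2).
    apply: cvgM => //; apply: cvgB; first exact: cvg_cst.
    apply: cvgMl; apply: cvgMr; apply: cvgB => //; exact: cvg_cst.
  apply: (ler_cvg_to c1 c3).
  by apply: nearW => n /=; rewrite -sin2cos2; exact: (bE _ (uP n)).
have lP : 0 <= l < pi by rewrite l0.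
suff -> : 0 = l by [].
have cl := cos_half _ lP.
have : k * sin (l / 2) ^+ 2 <= 0.
  rewrite sin2cos2.
  by move: limE; rewrite ler_pMr ?exprn_gt0//; lra.
rewrite pmulr_rle0// => s0.
apply/eqP; rewrite eq_le l0/= leNgt; apply/negP => l_gt0.
suff : 0 < sin (l / 2) ^+ 2 by rewrite ltNge s0.
by rewrite exprn_gt0// sin_gt0_pi//; lra.
Qed.

End half_angles.

(** * Integrals of multivector fields *)

Section correlation.
Variables (R : realType) (m : nat).
Local Notation Rm := (m.-tuple (measurableTypeR R)).
Local Notation mu := (@lebesgue_tuple R m).
Implicit Types (A B : Rm -> cl3 R) (E : cl3 R).

Definition cl_measurable A := forall I, measurable_fun [set: Rm] (fun x => A x I).

Lemma cl_measurable_cst E : cl_measurable (fun=> E).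
Proof. by move=> I; exact: measurable_cst. Qed.

Lemma cl_measurableM A B : cl_measurable A -> cl_measurable B ->
  cl_measurable (fun x => A x * B x).
Proof.
move=> mA mB I; under eq_fun do rewrite cl_mulE.
apply: measurable_sum => J; apply: measurable_funM; first exact: measurable_cst.
by apply: measurable_funM; [exact: mA|exact: mB].
Qed.

Definition cl_integrable A :=
  forall I, mu.-integrable [set: Rm] (fun x => (A x I)%:E).

Lemma integrable_scalar_part E A : cl_integrable A ->
  mu.-integrable [set: Rm] (EFin \o (fun x => scalar_part (E * A x))).
Proof.
move=> iA; rewrite /comp; under eq_fun => x do rewrite scalar_partM -sumEFin.
apply: (integrable_sum measurableT) => I _; under eq_fun do rewrite mulrA EFinM.
exact: (integrableZl measurableT).
Qed.

Lemma scalar_part_cl_integral E A : cl_integrable A ->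
  scalar_part (E * cl_integral A) = \int[mu]_x scalar_part (E * A x).
Proof.
move=> iA; rewrite scalar_partM /Rintegral.
under eq_integral => x _ do rewrite scalar_partM -sumEFin.
have iEA I : mu.-integrable [set: Rm]
    (EFin \o (fun x => blade_sign R I I * (E I * A x I))).
  rewrite /comp; under eq_fun do rewrite mulrA EFinM; exact: (integrableZl measurableT).
rewrite (integral_sum measurableT iEA) -sum_fine => [|I _]; last first.
  exact: (integrable_fin_num measurableT).
apply: eq_bigr => I _; rewrite ffunE mulrA -(RintegralZl _ measurableT (iA I)).
by apply: eq_Rintegral => x _; rewrite mulrA.
Qed.

(** * The rotated field *)
Section rotation.
Variables (v : Rm -> cl3 R) (P : cl3 R).
Hypothesis v_vector : forall x, is_vector (v x).
Hypothesis P_unit : unit_bivector P.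
Local Notation q := (fun x => scalar_part (v x ^+ 2)).
Local Notation rot := (fun t => outer_rotation P t v).

Lemma vector_mulE x : v x * v x = (q x)%:A.
Proof. by rewrite -expr2 (vector_sqrP (v_vector x)).1 scalar_part_alg. Qed.

Lemma cl_sqnorm_vector x : cl_sqnorm (v x) = q x.
Proof. by rewrite /cl_sqnorm reversion_vector. Qed.

Lemma reversion_rotation t x : reversion (rot t x) = rot t x.
Proof.
by rewrite !reversionM !(reversion_exp P_unit) opprK reversion_vector// mulrA.
Qed.

Lemma rotation_mulE t x : rot t x * rot t x = (q x)%:A.
Proof.
rewrite /outer_rotation -!mulrA (mulrA (cl_exp (t / 2) P)) cl_expNr// mul1r.
by rewrite (mulrA (v x)) vector_mulE mulr_algl -scalerAr cl_expNl.
Qed.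

Lemma cl_sqnorm_rotation t x : cl_sqnorm (rot t x) = q x.
Proof. by rewrite /cl_sqnorm reversion_rotation rotation_mulE scalar_part_alg. Qed.

Lemma norm2_rotation t : norm2 (rot t) = norm2 v.
Proof.
congr (Num.sqrt (fine _)); apply: eq_integral => x _.
by rewrite expr2 rotation_mulE scalar_part_alg.
Qed.

Lemma cl_sqnorm_correlation t x : cl_sqnorm (rot t x * v x) = q x ^+ 2.
Proof.
rewrite /cl_sqnorm reversionM reversion_rotation reversion_vector//.
rewrite -mulrA (mulrA (rot t x)) rotation_mulE mulr_algl -scalerAr vector_mulE.
by rewrite scalar_partZ scalar_part_alg expr2.
Qed.

(** e^((t/2) P) cancels the left factor of the rotated vector; what remains is
    <v e^((t/2) P) v>, and v can be moved cyclically to form the scalar v v. *)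
Lemma correlation_half_rotation t x :
  scalar_part (cl_exp (t / 2) P * (rot t x * v x)) = cos (t / 2) * q x.
Proof.
rewrite /outer_rotation !mulrA cl_expNr// mul1r -mulrA scalar_partMC -mulrA.
by rewrite vector_mulE mulr_algr scalar_partZ scalar_part_exp// mulrC.
Qed.

(** Both e^(s Q) u, for the rotated vector u, and v have squared norm v^2, so this
    is [scalar_part_le]. *)
Lemma correlation_rotor_le Q s t x : unit_bivector Q ->
  scalar_part (cl_exp s Q * (rot t x * v x)) <= q x.
Proof.
move=> Q_unit; rewrite mulrA scalar_partMC -{1}(reversion_vector (v_vector x)).
have := scalar_part_le (cl_exp s Q * rot t x) (v x).
rewrite cl_sqnorm_expMl// cl_sqnorm_rotation cl_sqnorm_vector; lra.
Qed.

(** The left side is |u - v|^2 for the rotated vector u. It depends on the angle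
    only through sin (t/2), because u - v = e^(-(t/2) P) (v e^((t/2) P) -
    e^((t/2) P) v), and the scalar part of e^((t/2) P) drops out of the
    commutator. *)
Lemma correlation_defect t x : 2 * (q x - scalar_part (rot t x * v x)) =
  sin (t / 2) ^+ 2 * cl_sqnorm (v x * P - P * v x).
Proof.
transitivity (cl_sqnorm (rot t x - v x)).
  rewrite cl_sqnormB cl_sqnorm_rotation cl_sqnorm_vector reversion_vector//.
  rewrite (scalar_partMC (v x)); ring.
have -> : rot t x - v x =
    cl_exp (- (t / 2)) P * (sin (t / 2) *: (v x * P - P * v x)).
  rewrite -[X in _ - X = _]mul1r -(cl_expNl P_unit (t / 2)) /outer_rotation.
  rewrite -!mulrA -mulrBr; congr (_ * _); rewrite /cl_exp mulrDl mulrDr.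
  rewrite mulr_algl mulr_algr -scalerAl -scalerAr opprD addrACA subrr.
  by rewrite add0r -scalerBr.
by rewrite cl_sqnorm_expMl// cl_sqnormZ.
Qed.

(** * The normalized correlation *)
Section square_integrable.
Hypothesis v_measurable : cl_measurable v.
Hypothesis v_finite : (sqr_norm v < +oo)%E.

Lemma integrable_vector_sqr : mu.-integrable [set: Rm] (EFin \o q).
Proof.
apply/integrableP; split.
  apply/measurable_EFinP; under eq_fun do rewrite expr2.
  exact: (cl_measurableM v_measurable v_measurable).
rewrite (_ : (\int[mu]_x _)%E = sqr_norm v)//; apply: eq_integral => x _.
by rewrite /= ger0_norm// (vector_sqrP (v_vector x)).2.
Qed.

Lemma norm2_sqr : norm2 v ^+ 2 = \int[mu]_x q x.
Proof.
rewrite sqr_sqrtr// Rintegral_ge0// => x _; exact: (vector_sqrP (v_vector x)).2.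
Qed.

(** Each coefficient is at most the norm of u v, and that norm is v^2. *)
Lemma integrable_correlation t : cl_integrable (fun x => rot t x * v x).
Proof.
move=> I; apply: (le_integrable measurableT) integrable_vector_sqr => /=.
  apply/measurable_EFinP; have mE := cl_measurable_cst.
  exact: (cl_measurableM (cl_measurableM (cl_measurableM (mE _) v_measurable) (mE _))
    v_measurable).
move=> x _; rewrite lee_fin -ler_sqr ?nnegrE ?normr_ge0// !real_normK ?num_real//.
by rewrite -(cl_sqnorm_correlation t) cl_sqnorm_coef.
Qed.

Lemma scalar_part_normalized_correlation E t :
  scalar_part (E * normalized_correlation P t v) =
  (norm2 v ^+ 2)^-1 * \int[mu]_x scalar_part (E * (rot t x * v x)).
Proof.
rewrite /normalized_correlation norm2_rotation -scalerAr scalar_partZ -expr2.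
rewrite -scalar_part_cl_integral; last exact: integrable_correlation.
congr (_ * scalar_part (_ * cl_integral _)); apply/funext => x.
rewrite reversion_rotation; congr (_ * v _).
by apply: eq_from_tnth => i; rewrite !tnth_mktuple addr0.
Qed.

Hypothesis v_neq0 : norm2 v != 0.

Let norm2_gt0 : 0 < norm2 v ^+ 2.
Proof. by rewrite exprn_even_gt0. Qed.

Lemma normalized_correlation_half_rotation t :
  scalar_part (cl_exp (t / 2) P * normalized_correlation P t v) = cos (t / 2).
Proof.
rewrite scalar_part_normalized_correlation.
under eq_Rintegral do rewrite correlation_half_rotation.
rewrite RintegralZl//; last exact: integrable_vector_sqr.
by rewrite -norm2_sqr mulrC mulfK// gt_eqF.
Qed.

Lemma normalized_correlation_rotor_le Q s t : unit_bivector Q ->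
  scalar_part (cl_exp s Q * normalized_correlation P t v) <= 1.
Proof.
move=> Q_unit; rewrite scalar_part_normalized_correlation mulrC ler_pdivrMr//.
rewrite mul1r norm2_sqr; apply: le_Rintegral => //.
- exact: (integrable_scalar_part _ (integrable_correlation t)).
- exact: integrable_vector_sqr.
- by move=> x _; exact: correlation_rotor_le.
Qed.

Let defect t x := q x - scalar_part (rot t x * v x).

Let integrable_scalar_correlation t :
  mu.-integrable [set: Rm] (EFin \o (fun x => scalar_part (rot t x * v x))).
Proof.
have := integrable_scalar_part 1 (integrable_correlation t).
by rewrite /comp; under eq_fun do rewrite mul1r.
Qed.

Let integrable_defect t : mu.-integrable [set: Rm] (EFin \o defect t).
Proof.
exact: (integrableB measurableT integrable_vector_sqr
  (integrable_scalar_correlation t)).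
Qed.

Let integral_defect t :
  1 - scalar_part (normalized_correlation P t v) =
  (norm2 v ^+ 2)^-1 * \int[mu]_x defect t x.
Proof.
rewrite (RintegralB measurableT integrable_vector_sqr
  (integrable_scalar_correlation t)).
rewrite -norm2_sqr mulrBr mulVf ?gt_eqF//; congr (1 - _).
rewrite -[normalized_correlation _ _ _]mul1r scalar_part_normalized_correlation.
by under eq_Rintegral do rewrite mul1r.
Qed.

(** The angle pi is the reference since sin (pi/2) = 1; the first factor on the
    right is the rate constant of the iteration. *)
Lemma normalized_correlation_scalar_part t :
  1 - scalar_part (normalized_correlation P t v) =
  (1 - scalar_part (normalized_correlation P pi v)) * sin (t / 2) ^+ 2.
Proof.
apply: (etrans (integral_defect t)).
apply: (etrans _ (congr1 (fun k => k * _) (esym (integral_defect pi)))) => /=.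
rewrite -[RHS]mulrA -(RintegralZr _ measurableT (integrable_defect pi)).
congr (_ * _); apply: eq_Rintegral => x _.
have := correlation_defect t x; have := correlation_defect pi x.
rewrite sin_pihalf expr1n mul1r -/(defect pi x) -/(defect t x) => <- dt.
apply: (mulfI (_ : 2 != 0 :> R)); first by rewrite pnatr_eq0.
by rewrite dt; ring.
Qed.

(** Otherwise the integral of |v P - P v|^2 vanishes, so that v commutes with P,
    hence with every e^(t P), almost everywhere. *)
Lemma normalized_correlation_pi_lt1 : ~ rotation_invariant P v ->
  scalar_part (normalized_correlation P pi v) < 1.
Proof.
move=> v_rot; rewrite ltNge; apply/negP => G1; apply: v_rot => t.
have dE x : defect pi x = cl_sqnorm (v x * P - P * v x) / 2.
  have := correlation_defect pi x; rewrite sin_pihalf expr1n mul1r => <-.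
  by rewrite mulrC mulKf// pnatr_eq0.
have d0 x : 0 <= defect pi x by rewrite dE divr_ge0// cl_sqnorm_ge0.
have int0 : \int[mu]_x defect pi x = 0.
  apply/eqP; rewrite eq_le Rintegral_ge0// andbT.
  rewrite -(@pmulr_rle0 _ (norm2 v ^+ 2)^-1) ?invr_gt0// -integral_defect.
  by rewrite subr_le0.
have abs0 : (\int[mu]_x `|(EFin \o defect pi) x| = 0)%E.
  rewrite -[RHS]/(0%:E) -int0 fineK; last first.
    exact: (integrable_fin_num measurableT (integrable_defect pi)).
  by apply: eq_integral => x _; rewrite /= ger0_norm.
have /integrableP[md _] := integrable_defect pi.
move/(ae_eq_integral_abs mu measurableT md) : abs0.
apply: filterS => x /= /(_ I) []; rewrite dE => /eqP.
rewrite mulf_eq0 invr_eq0 pnatr_eq0 orbF => /eqP/cl_sqnorm_eq0/eqP.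
rewrite subr_eq0 => /eqP vP.
have vE s : cl_exp s P * v x = v x * cl_exp s P.
  by rewrite /cl_exp mulrDl mulrDr mulr_algl mulr_algr -scalerAl -scalerAr vP.
by rewrite /outer_rotation vE -mulrA cl_expNl// mulr1.
Qed.

End square_integrable.
End rotation.
End correlation.

(** * Convergence of the iteration *)

Theorem theorem3p2 (R : realType) (m : nat) (m_ge1 : (1 <= m)%N)
  (v : m.-tuple (measurableTypeR R) -> cl3 R)
  (v_L2 : L2_vector_field v) (v_neq0 : norm2 v != 0)
  (P : cl3 R) (P_unit : unit_bivector P)
  (v_rot : ~ rotation_invariant P v)
  (phi : R -> R) (Q : R -> cl3 R)
  (phiQ : forall alpha, 0 <= alpha < pi ->
     exists r, polar_form (normalized_correlation P alpha v) r (phi alpha) (Q alpha))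
  (beta : R -> R)
  (betaE : forall alpha, 0 <= alpha < pi ->
     beta alpha =
       2 * cl_arg (cl_exp (alpha / 2) P * cl_exp (phi alpha / 2) (Q alpha))) :
  (forall alpha, 0 <= alpha < pi -> 0 <= beta alpha < pi) /\
  (forall alpha, 0 <= alpha < pi -> iter n beta alpha @[n --> \oo] --> (0 : R)).
Proof.
have [v1 mv fv] := v_L2.
pose G := fun t => normalized_correlation P t v.
set k := 1 - scalar_part (G pi).
have k0 : 0 < k by rewrite subr_gt0; exact: normalized_correlation_pi_lt1.
have step a : 0 <= a < pi -> 0 <= beta a < pi /\
    cos (a / 2) ^+ 2 <= cos (beta a / 2) ^+ 2 * (1 - k * sin (a / 2) ^+ 2 / 2).
  move=> aP; have [r Gr] := phiQ a aP; rewrite betaE//.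
  have [r0 _ _ Q_unit _] := Gr.
  set D := cl_exp (a / 2) P * cl_exp (phi a / 2) (Q a).
  have c0 : 0 < cos (a / 2).
    by move/andP: aP => [a0 api]; apply: cos_gt0_pihalf; lra.
  have GE : 1 - scalar_part (G a) = k * sin (a / 2) ^+ 2.
    exact: normalized_correlation_scalar_part.
  have D1 : cl_sqnorm D = 1.
    rewrite cl_sqnorm_expMl// -[cl_exp _ _]mulr1 cl_sqnorm_expMl//.
    by rewrite /cl_sqnorm reversion1 mulr1 -[1]scale1r scalar_part_alg.
  have r1 : 0 <= r <= 1.
    by rewrite r0 (polar_form_modulus Gr) normalized_correlation_rotor_le.
  have g1 : scalar_part (G a) <= 1.
    by rewrite -subr_ge0 GE mulr_ge0 ?sqr_ge0// ltW.
  (* The scalar part of e^((a/2) P) (r + G a), computed in two ways. *)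
  have rD : 2 * cos (phi a / 2) * r * scalar_part D = cos (a / 2) * (1 + r).
    rewrite -scalar_partZ scalerAr (polar_form_half Gr) mulrDr scalar_partD.
    rewrite mulr_algr scalar_partZ scalar_part_exp//.
    by rewrite normalized_correlation_half_rotation//; ring.
  have [D0 cD] := half_angle_estimate c0 (polar_form_cos_half_ge0 Gr) r1 g1
    (polar_form_scalar_part Gr) rD.
  have [argD cosD] := cl_arg_acute D1 D0.
  have /andP[argD0 _] := cl_arg_ge0_pi D.
  split; first by apply/andP; split; lra.
  have -> : 2 * cl_arg D / 2 = cl_arg D by rewrite mulrC mulKf// pnatr_eq0.
  rewrite -GE; apply: (le_trans cD); apply: ler_wpM2r; last first.
    by rewrite ler_sqr ?nnegrE ?(le_trans (ltW D0))// ltW.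
  have rg0 : 0 <= r + scalar_part (G a).
    rewrite (polar_form_scalar_part Gr) mulr_ge0 ?sqr_ge0//; lra.
  move/andP: r1 => [_ r1]; lra.
split; first by move=> a /step[].
by apply: (iter_half_angle_cvg0 k0) => a /step[].
Qed.
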